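(* Let $\mathbb{F}$ be a field, $q\in\mathbb{F}$ and $f,g\in\mathbb{F}[h]$. The quantum generalized Heisenberg algebra $\mathcal{H}_q(f,g)$ is an ambiskew polynomial ring of endomorphism type over $\mathbb{F}[h]$. For any basis $\{v_j\}_{j\in\mathbb{Z}_{\geq 0}}$ of $\mathbb{F}[h]$ over $\mathbb{F}$, the set $\{x^i v_j y^k \mid i,j,k\in\mathbb{Z}_{\geq 0}\}$ is a basis of $\mathcal{H}_q(f,g)$ over $\mathbb{F}$. In particular, for each $j\geq 0$, one can take $v_j$ to be any polynomial in $h$ of degree $j$.
   Context: $\mathcal{H}_q(f,g)$ is the unital associative $\mathbb{F}$-algebra generated by $x,y,h$ with defining relations $hx=xf(h)$, $yh=f(h)y$, $yx-qxy=g(h)$. An ambiskew polynomial ring of endomorphism type over a commutative $\mathbb{F}$-algebra $A$ is a ring obtained from an algebra endomorphism $\sigma$ of $A$ (not necessarily bijective), an element $c\in A$ and a scalar $\rho\in\mathbb{F}$ as a 2-step Ore extension: first form the skew polynomial ring $B=A[y;\sigma]$ with coefficients on the left, i.e. $B=\bigoplus_{k\ge 0}Ay^k$ is a free left $A$-module and $ya=\sigma(a)y$ for $a\in A$; then form the Ore extension $R=\bigoplus_{i\ge 0}x^iB$ with coefficients on the right (a free right $B$-module), with $bx=x\tau(b)+\delta(b)$ for $b\in B$, where $\tau$ is the endomorphism of $B$ with $\tau|_A=\sigma$, $\tau(y)=\rho y$, and $\delta:B\to B$ is the $\mathbb{F}$-linear map satisfying $\delta(bb')=\delta(b)\tau(b')+b\delta(b')$,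 $\delta(A)=0$, $\delta(y)=c$. For $\mathcal{H}_q(f,g)$ the data are $A=\mathbb{F}[h]$, $\sigma:h\mapsto f(h)$, $\rho=q$, $c=g$. *)

(* Defs.v *)
From HB Require Import structures.
From mathcomp Require Import all_boot all_algebra.
From mathcomp Require Import generic_quotient ring_quotient.
From mathcomp Require Import boolp.
From mathcomp Require Import xfinmap monalg.

Set Implicit Arguments.
Unset Strict Implicit.
Unset Printing Implicit Defensive.

Import GRing.Theory.
Local Open Scope ring_scope.

(* Families, not sets: a basis in this sense is automatically injective. *)
Definition is_basis (F : fieldType) (V : lmodType F) (I : eqType)
    (v : I -> V) : Prop :=
  (forall (s : seq I) (c : I -> F), uniq s ->
     \sum_(i <- s) c i *: v i = 0 -> forall i, i \in s -> c i = 0)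
  /\ (forall u : V, exists (s : seq I) (c : I -> F),
        u = \sum_(i <- s) c i *: v i).

(* In the next two definitions a polynomial only serves as a finitely
   supported sequence of coefficients. *)

(* [B = A[y; sigma]], coefficients on the left, [A] embedded by [iota]. *)
Definition is_skew_polynomial_ring (F : fieldType) (A : comAlgType F)
    (sigma : {lrmorphism A -> A}) (B : algType F)
    (iota : {lrmorphism A -> B}) (y : B) : Prop :=
  (forall a : A, y * iota a = iota (sigma a) * y)
  /\ (forall b : B, exists! p : {poly A},
        b = \sum_(k < size p) iota p`_k * y ^+ k).

(* [R = B[x; tau, delta]], coefficients on the right, [B] embedded by [j]. *)
Definition is_right_ore_extension (F : fieldType) (B : algType F)
    (tau : {lrmorphism B -> B}) (delta : {linear B -> B}) (R : algType F)
    (j : {lrmorphism B -> R}) (x : R) : Prop :=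
  [/\ forall b b' : B, delta (b * b') = delta b * tau b' + b * delta b',
      forall b : B, j b * x = x * j (tau b) + j (delta b)
    & forall r : R, exists! p : {poly B},
        r = \sum_(i < size p) x ^+ i * j p`_i].

(* [R], with structure map [phi : A -> R] and Ore variables [x] and [y], is the
   ambiskew polynomial ring of endomorphism type with data
   [(A, sigma, c, rho)]. *)
Definition is_ambiskew_polynomial_ring (F : fieldType) (A : comAlgType F)
    (sigma : {lrmorphism A -> A}) (c : A) (rho : F)
    (R : algType F) (phi : A -> R) (x y : R) : Prop :=
  exists (B : algType F) (iota : {lrmorphism A -> B}) (yB : B)
         (tau : {lrmorphism B -> B}) (delta : {linear B -> B})
         (j : {lrmorphism B -> R}),
    [/\ is_skew_polynomial_ring sigma iota yB,
        is_right_ore_extension tau delta j x,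
        (forall a, tau (iota a) = iota (sigma a)) /\ tau yB = rho *: yB,
        (forall a, delta (iota a) = 0) /\ delta yB = iota c
      & (forall a, phi a = j (iota a)) /\ y = j yB].

Inductive ideal_generated (R : nzRingType) (S : R -> Prop) : R -> Prop :=
| ideal_generator u : S u -> ideal_generated S u
| ideal_zero : ideal_generated S 0
| ideal_add u v :
    ideal_generated S u -> ideal_generated S v -> ideal_generated S (u + v)
| ideal_mull a u : ideal_generated S u -> ideal_generated S (a * u)
| ideal_mulr a u : ideal_generated S u -> ideal_generated S (u * a).

Definition free_alg3 (F : fieldType) : Type := {malg F[{fmonom 'I_3}]}.

HB.instance Definition _ (F : fieldType) :=
  GRing.Lalgebra.copy (free_alg3 F) {malg F[{fmonom 'I_3}]}.

Lemma malg_scalerAr (F : fieldType) (K : monomType) (c : F)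
  (u v : {malg F[K]}) : c *: (u * v) = u * (c *: v).
Proof.
rewrite [u * v]malgME (malgMEw (fsubset_refl (msupp u)) (msuppZ_le c v)).
rewrite scaler_sumr; apply: eq_bigr => k _.
rewrite scaler_sumr; apply: eq_bigr => l _.
by apply/malgP => m; rewrite !(mcoeffZ, mcoeffU) mulrCA mulrnAr.
Qed.

HB.instance Definition _ (F : fieldType) :=
  GRing.Lalgebra_isAlgebra.Build F (free_alg3 F) (@malg_scalerAr F _).

Definition free_gen (F : fieldType) (i : 'I_3) : free_alg3 F := << fmu i >>.
Definition freeX (F : fieldType) : free_alg3 F := free_gen F 0.
Definition freeY (F : fieldType) : free_alg3 F := free_gen F 1.
Definition freeH (F : fieldType) : free_alg3 F := free_gen F 2.

Lemma lrmorph_horner_alg (F : fieldType) (A B : algType F)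
  (phi : {lrmorphism A -> B}) (a : A) (p : {poly F}) :
  phi (horner_alg a p) = horner_alg (phi a) p.
Proof.
elim/poly_ind: p => [|p c IH]; first by rewrite !rmorph0.
by rewrite !rmorphD !rmorphM /= IH !horner_algX !horner_algC linearZ /= rmorph1.
Qed.

Section QuantumGeneralizedHeisenbergAlgebra.

Context {F : fieldType}.

Inductive qgha_rel (q : F) (f g : {poly F}) : free_alg3 F -> Prop :=
| qgha_rel_hx :
    qgha_rel q f g (freeH F * freeX F - freeX F * horner_alg (freeH F) f)
| qgha_rel_yh :
    qgha_rel q f g (freeY F * freeH F - horner_alg (freeH F) f * freeY F)
| qgha_rel_yx :
    qgha_rel q f g (freeY F * freeX F - q *: (freeX F * freeY F)
                    - horner_alg (freeH F) g).

Definition qgha_ideal (q : F) (f g : {poly F}) : {pred free_alg3 F} :=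
  fun u => `[< ideal_generated (qgha_rel q f g) u >].

Lemma qgha_idealP (q : F) (f g : {poly F}) (u : free_alg3 F) :
  reflect (ideal_generated (qgha_rel q f g) u) (u \in qgha_ideal q f g).
Proof. exact: asboolP. Qed.

Fact qgha_ideal_zmod_closed (q : F) (f g : {poly F}) :
  zmod_closed (qgha_ideal q f g).
Proof.
split=> [|u v /qgha_idealP Iu /qgha_idealP Iv]; apply/qgha_idealP.
  exact: ideal_zero.
by apply: ideal_add => //; rewrite -mulN1r; apply: ideal_mull.
Qed.

HB.instance Definition _ (q : F) (f g : {poly F}) :=
  GRing.isZmodClosed.Build (free_alg3 F) (qgha_ideal q f g)
    (qgha_ideal_zmod_closed q f g).

(* The ideal is proper: in the representation below on sequences of
   polynomials, [v] stands for the formal sum of the [x ^+ i * v i] in the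
   quotient of the algebra by the left ideal generated by [y]. *)

Section Representation.

Variables (q : F) (f g : {poly F}).

Fixpoint rep_h (i : nat) : {poly F} :=
  if i is i'.+1 then f \Po rep_h i' else 'X.

Fixpoint rep_y (i : nat) : {poly F} :=
  if i is i'.+1 then q%:P * rep_y i' + (g \Po rep_h i') else 0.

Definition rep_gen (k : 'I_3) (v : nat -> {poly F}) : nat -> {poly F} :=
  match val k with
  | 0 => fun i => if i is i'.+1 then v i' else 0
  | 1 => fun i => rep_y i.+1 * v i.+1
  | _ => fun i => rep_h i * v i
  end.

Definition rep_word (w : seq 'I_3) (v : nat -> {poly F}) : nat -> {poly F} :=
  foldr rep_gen v w.

Definition rep (u : free_alg3 F) (v : nat -> {poly F}) : nat -> {poly F} :=
  fun i => \sum_(w <- msupp u) (u@_w)%:P * rep_word w v i.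

Lemma rep_wordZ w c v :
  rep_word w (fun i => c%:P * v i) = fun i => c%:P * rep_word w v i.
Proof.
elim: w => //= k w ->; apply/funext => i; rewrite /rep_gen.
case: (val k) => [|[|_]]; last 2 first.
- by rewrite mulrCA.
- by rewrite mulrCA.
by case: i => //; rewrite mulr0.
Qed.

Lemma rep_word_sum w (T : Type) (s : seq T) (v : T -> nat -> {poly F}) :
  rep_word w (fun i => \sum_(t <- s) v t i)
  = fun i => \sum_(t <- s) rep_word w (v t) i.
Proof.
elim: w => //= k w ->; apply/funext => i; rewrite /rep_gen.
case: (val k) => [|[|_]]; last 2 first.
- by rewrite mulr_sumr.
- by rewrite mulr_sumr.
by case: i => //; rewrite big1.
Qed.

Lemma repEw (d : {fset {fmonom 'I_3}}) (u : free_alg3 F) v i :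
  (msupp u `<=` d)%fset ->
  rep u v i = \sum_(w <- d) (u@_w)%:P * rep_word w v i.
Proof.
move=> le; rewrite /rep (big_fset_incl _ le) //= => w _ /mcoeff_outdom ->.
by rewrite polyC0 mul0r.
Qed.

Lemma repU c w v i :
  rep (<< c *g w >> : {malg F[{fmonom 'I_3}]}) v i = c%:P * rep_word w v i.
Proof. by rewrite (repEw _ _ msuppU_le) big_seq_fset1 mcoeffUU. Qed.

Lemma rep_lin c (u u' : free_alg3 F) v i :
  rep (c *: u + u') v i = c%:P * rep u v i + rep u' v i.
Proof.
set d := (msupp u `|` msupp u')%fset.
have le1 : (msupp u `<=` d)%fset by exact: fsubsetUl.
have le2 : (msupp u' `<=` d)%fset by exact: fsubsetUr.
have le3 : (msupp (c *: u + u') `<=` d)%fset.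
  apply: fsubset_trans (msuppD_le _ _) _.
  by rewrite fsetSU // msuppZ_le.
rewrite (repEw _ _ le1) (repEw _ _ le2) (repEw _ _ le3) mulr_sumr -big_split.
apply: eq_bigr => w _ /=.
by rewrite mcoeffD mcoeffZ polyCD polyCM mulrDl mulrA.
Qed.

Lemma rep0 v i : rep 0 v i = 0.
Proof. by rewrite /rep msupp0 big_seq_fset0. Qed.

Lemma repD (u u' : free_alg3 F) v i : rep (u + u') v i = rep u v i + rep u' v i.
Proof. by rewrite -[u]scale1r rep_lin scale1r mul1r. Qed.

Lemma repZ c (u : free_alg3 F) v i : rep (c *: u) v i = c%:P * rep u v i.
Proof. by rewrite -[c *: u]addr0 rep_lin rep0 addr0. Qed.

Lemma repN (u : free_alg3 F) v i : rep (- u) v i = - rep u v i.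
Proof. by rewrite -scaleN1r repZ polyCN mulN1r. Qed.

Lemma rep_sum (T : Type) (s : seq T) (u : T -> free_alg3 F) v i :
  rep (\sum_(t <- s) u t) v i = \sum_(t <- s) rep (u t) v i.
Proof.
exact: (big_morph (fun u => rep u v i) (fun u u' => repD u u' v i) (rep0 v i)).
Qed.

Lemma repM (u u' : free_alg3 F) v : rep (u * u') v = rep u (rep u' v).
Proof.
apply/funext => i.
have -> : rep u (rep u' v) i = \sum_(w <- msupp u) (u@_w)%:P
    * \sum_(w' <- msupp u') (u'@_w')%:P * rep_word w (rep_word w' v) i.
  apply: eq_bigr => w _; congr (_ * _).
  rewrite /rep rep_word_sum; apply: eq_bigr => w' _.
  by rewrite rep_wordZ.
rewrite malgME rep_sum; apply: eq_bigr => w _.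
rewrite rep_sum mulr_sumr; apply: eq_bigr => w' _.
by rewrite repU polyCM mulrA fmM /rep_word foldr_cat.
Qed.

Lemma rep1 v : rep 1 v = v.
Proof. by apply/funext => i; rewrite repU mul1r fm1. Qed.

Lemma rep_free_gen k v : rep (free_gen F k) v = rep_gen k v.
Proof. by apply/funext => i; rewrite repU mul1r fmuE. Qed.

Lemma rep_horner p v i :
  rep (horner_alg (freeH F) p) v i = (p \Po rep_h i) * v i.
Proof.
elim/poly_ind: p v => [|p c IH] v.
  by rewrite rmorph0 rep0 comp_poly0 mul0r.
rewrite rmorphD rmorphM /= horner_algX horner_algC repD repM IH repZ rep1.
rewrite rep_free_gen comp_polyD comp_polyM comp_polyX comp_polyC.
by rewrite mulrDl mulrA.
Qed.

Lemma rep_qgha_rel u v i : qgha_rel q f g u -> rep u v i = 0.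
Proof.
case; rewrite !(repD, repN, repZ, repM, rep_horner) !rep_free_gen /rep_gen /=.
- by case: i => [|i]; rewrite ?mulr0 ?subr0 // rep_horner /= subrr.
- by rewrite mulrCA subrr.
- rewrite mulrDl addrAC addrK.
  by case: i => [|i] /=; rewrite ?(mulr0, mul0r) ?mulrA subrr.
Qed.

Lemma rep_ideal u v i : ideal_generated (qgha_rel q f g) u -> rep u v i = 0.
Proof.
have rep_zero a j : rep a (fun=> 0) j = 0.
  have -> : (fun=> 0) = (fun=> 0%:P * 0) :> (nat -> {poly F}).
    by apply: funext => k; rewrite mulr0.
  by rewrite [LHS]big1 // => w _; rewrite rep_wordZ mul0r mulr0.
move=> Iu; elim: Iu v i => {u}.
- by move=> u Su v i; exact: rep_qgha_rel.
- by move=> v i; rewrite rep0.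
- by move=> u u' _ IH _ IH' v i; rewrite repD IH IH' addr0.
- move=> a u _ IH v i; rewrite repM.
  have -> : rep u v = fun=> 0 by apply: funext => j; exact: IH.
  by rewrite rep_zero.
- by move=> a u _ IH v i; rewrite repM IH.
Qed.

End Representation.

Fact qgha_ideal_proper (q : F) (f g : {poly F}) : 1 \notin qgha_ideal q f g.
Proof.
apply/negP => /qgha_idealP /(rep_ideal (fun=> 1) 0) /eqP.
by rewrite rep1 oner_eq0.
Qed.

(* [Quotient.quot I] only carries the additive structure of the quotient. *)
Definition qgha (q : F) (f g : {poly F}) : Type :=
  Quotient.quot (qgha_ideal q f g).

Section Quotient.

Variables (q : F) (f g : {poly F}).

Local Notation H := (qgha q f g).
Local Notation I := (qgha_ideal q f g).
Local Open Scope quotient_scope.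

HB.instance Definition _ := GRing.Zmodule.copy H (Quotient.quot I).

Definition qgha_proj (u : free_alg3 F) : H := \pi_(Quotient.quot I) u.
Definition qgha_lift (a : H) : free_alg3 F := repr (a : Quotient.quot I).

Definition qgha_one : H := qgha_proj 1.
Definition qgha_mul (a b : H) : H := qgha_proj (qgha_lift a * qgha_lift b).
Definition qgha_scale (c : F) (a : H) : H := qgha_proj (c *: qgha_lift a).

Lemma qgha_liftK : cancel qgha_lift qgha_proj.
Proof. exact: reprK. Qed.

Lemma qgha_proj_eq u v : u - v \in I -> qgha_proj u = qgha_proj v.
Proof. by rewrite Quotient.idealrBE => /eqP. Qed.

Lemma qgha_projK u : qgha_lift (qgha_proj u) - u \in I.
Proof. by rewrite Quotient.idealrBE; apply/eqP; exact: reprK. Qed.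

Lemma qgha_ideal_mull a u : u \in I -> a * u \in I.
Proof. by move=> /qgha_idealP Iu; apply/qgha_idealP/ideal_mull. Qed.

Lemma qgha_ideal_mulr a u : u \in I -> u * a \in I.
Proof. by move=> /qgha_idealP Iu; apply/qgha_idealP/ideal_mulr. Qed.

Lemma qgha_projD u v : qgha_proj (u + v) = qgha_proj u + qgha_proj v.
Proof. exact: (Quotient.pi_add I). Qed.

Lemma qgha_projM u v : qgha_proj (u * v) = qgha_mul (qgha_proj u) (qgha_proj v).
Proof.
have mulBmul (R : nzRingType) (a b c d : R) :
  a * b - c * d = a * (b - d) + (a - c) * d.
  by rewrite mulrBr mulrBl addrA subrK.
apply/esym/qgha_proj_eq; rewrite mulBmul; apply: rpredD.
  exact: qgha_ideal_mull (qgha_projK v).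
exact: qgha_ideal_mulr (qgha_projK u).
Qed.

Lemma qgha_projZ c u : qgha_proj (c *: u) = qgha_scale c (qgha_proj u).
Proof.
apply/esym/qgha_proj_eq; rewrite -scalerBr -[_ *: _]mul1r -scalerAr scalerAl.
exact: qgha_ideal_mull (qgha_projK u).
Qed.

Fact qgha_mulA : associative qgha_mul.
Proof.
move=> a b c; rewrite -(qgha_liftK a) -(qgha_liftK b) -(qgha_liftK c).
by rewrite -!qgha_projM mulrA.
Qed.

Fact qgha_mul1 : left_id qgha_one qgha_mul.
Proof. by move=> a; rewrite -(qgha_liftK a) -!qgha_projM mul1r. Qed.

Fact qgha_mulr1 : right_id qgha_one qgha_mul.
Proof. by move=> a; rewrite -(qgha_liftK a) -!qgha_projM mulr1. Qed.

Fact qgha_mulDl : left_distributive qgha_mul +%R.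
Proof.
move=> a b c; rewrite -(qgha_liftK a) -(qgha_liftK b) -(qgha_liftK c).
by rewrite -!(qgha_projM, qgha_projD) mulrDl.
Qed.

Fact qgha_mulDr : right_distributive qgha_mul +%R.
Proof.
move=> a b c; rewrite -(qgha_liftK a) -(qgha_liftK b) -(qgha_liftK c).
by rewrite -!(qgha_projM, qgha_projD) mulrDr.
Qed.

Fact qgha_oner_neq0 : qgha_one != 0.
Proof.
have -> : (0 : H) = qgha_proj 0.
  by apply: (addrI (qgha_proj 0)); rewrite -qgha_projD !addr0.
rewrite -(Quotient.idealrBE I) subr0; exact: qgha_ideal_proper.
Qed.

HB.instance Definition _ :=
  GRing.Zmodule_isNzRing.Build H qgha_mulA qgha_mul1 qgha_mulr1
    qgha_mulDl qgha_mulDr qgha_oner_neq0.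

Fact qgha_scaleA c d a : qgha_scale c (qgha_scale d a) = qgha_scale (c * d) a.
Proof. by rewrite -(qgha_liftK a) -!qgha_projZ scalerA. Qed.

Fact qgha_scale1 : left_id 1 qgha_scale.
Proof. by move=> a; rewrite -(qgha_liftK a) -!qgha_projZ scale1r. Qed.

Fact qgha_scaleDr : right_distributive qgha_scale +%R.
Proof.
move=> c a b; rewrite -(qgha_liftK a) -(qgha_liftK b).
by rewrite -!(qgha_projZ, qgha_projD) scalerDr.
Qed.

Fact qgha_scaleDl a : {morph qgha_scale^~ a : c d / c + d}.
Proof.
by move=> c d; rewrite -(qgha_liftK a) -!(qgha_projZ, qgha_projD) scalerDl.
Qed.

HB.instance Definition _ :=
  GRing.Zmodule_isLmodule.Build F H qgha_scaleA qgha_scale1 qgha_scaleDr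
    qgha_scaleDl.

Fact qgha_scaleAl (c : F) (a b : H) : c *: (a * b) = c *: a * b.
Proof.
rewrite -(qgha_liftK a) -(qgha_liftK b).
by rewrite /GRing.mul /GRing.scale /= -!(qgha_projZ, qgha_projM) scalerAl.
Qed.

Fact qgha_scaleAr (c : F) (a b : H) : c *: (a * b) = a * (c *: b).
Proof.
rewrite -(qgha_liftK a) -(qgha_liftK b).
by rewrite /GRing.mul /GRing.scale /= -!(qgha_projZ, qgha_projM) scalerAr.
Qed.

HB.instance Definition _ := GRing.Lmodule_isLalgebra.Build F H qgha_scaleAl.
HB.instance Definition _ := GRing.Lalgebra_isAlgebra.Build F H qgha_scaleAr.

Fact qgha_proj_is_monoid_morphism : monoid_morphism qgha_proj.
Proof. by split; [exact: erefl | exact: qgha_projM]. Qed.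

Fact qgha_proj_is_semilinear : semilinear qgha_proj.
Proof. by split; [exact: qgha_projZ | exact: qgha_projD]. Qed.

HB.instance Definition _ :=
  GRing.isSemilinear.Build F (free_alg3 F) H *:%R qgha_proj
    qgha_proj_is_semilinear.
HB.instance Definition _ :=
  GRing.isMonoidMorphism.Build (free_alg3 F) H qgha_proj
    qgha_proj_is_monoid_morphism.

Definition qghaX : H := qgha_proj (freeX F).
Definition qghaY : H := qgha_proj (freeY F).
Definition qghaH : H := qgha_proj (freeH F).

Lemma qgha_proj_horner (p : {poly F}) :
  qgha_proj (horner_alg (freeH F) p) = horner_alg qghaH p.
Proof. exact: (lrmorph_horner_alg qgha_proj). Qed.

Lemma qgha_hx : qghaH * qghaX = qghaX * horner_alg qghaH f.
Proof.
rewrite -qgha_proj_horner -!rmorphM; apply: qgha_proj_eq.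
exact/qgha_idealP/ideal_generator/qgha_rel_hx.
Qed.

Lemma qgha_yh : qghaY * qghaH = horner_alg qghaH f * qghaY.
Proof.
rewrite -qgha_proj_horner -!rmorphM; apply: qgha_proj_eq.
exact/qgha_idealP/ideal_generator/qgha_rel_yh.
Qed.

Lemma qgha_yx : qghaY * qghaX - q *: (qghaX * qghaY) = horner_alg qghaH g.
Proof.
rewrite -qgha_proj_horner -!rmorphM -linearZ -rmorphB; apply: qgha_proj_eq.
exact/qgha_idealP/ideal_generator/qgha_rel_yx.
Qed.

End Quotient.

End QuantumGeneralizedHeisenbergAlgebra.

(* Main.v *)
Require Import Defs.
From HB Require Import structures.
From mathcomp Require Import all_boot all_algebra.
From mathcomp Require Import boolp functions xfinmap monalg.

(** The theorem is the diamond lemma for the three rewriting rules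
    [h x -> x f(h)], [y h -> f(h) y] and [y x -> q x y + g(h)], in a form that
    yields the Ore structure as well as the basis.

    Independence is obtained from a representation instead of a confluence
    argument.  If the sums of the [x^i a(h) y^k] are to be normal forms, then
    left multiplication by a generator must act on them by
<<
      x . x^i a y^k = x^(i+1) a y^k
      h . x^i a y^k = x^i sigma^i(h) a y^k
      y . x^i a y^k = q^i x^i sigma(a) y^(k+1)
                      + x^(i-1) (sum_(j < i) q^j sigma^(i-1-j)(g)) a y^k
>>
    where [sigma] is the substitution of [f] for [h].  These formulas define
    three operators on formal sums of such terms, and the operators satisfy the
    defining relations ([act_qgha_rel]), so the algebra acts on formal sums.
    Applied to the formal sum [1], the element [x^i a(h) y^k] gives back the
    formal sum [x^i a y^k] ([qgha_coord_monomial]): this coordinate map shows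
    that an element has at most one normal form.

    The rest uses only the relations, the fact that [x], [y], [h] generate, and
    the existence of the coordinate map, and is therefore done in an arbitrary
    algebra [R] with these three properties.  The sums of the [a(h) y^k] are a
    subalgebra [B], the skew polynomial ring.  The maps [tau] and [delta] are
    not built by formulas: every [b] in [B] satisfies [b x = x t + d] for some
    [t], [d] in [B], and [t], [d] are unique by the coordinate map, so that the
    multiplicativity of [tau] and the Leibniz rule of [delta] are read off from
    [(b b') x = b (b' x)] ([tau_delta_mul]).  The same equation moves elements
    of [B] to the right of powers of [x], hence every element of [R] has a
    normal form ([ore_eval_surj]). *)

Set Implicit Arguments.
Unset Strict Implicit.
Unset Printing Implicit Defensive.

Import GRing.Theory.
Local Open Scope ring_scope.

(** * Actions of the free algebra *)

Section FreeAlgebra.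

Context {F : fieldType}.

Lemma free_alg3_ind (P : free_alg3 F -> Prop) :
  P 0 -> P 1 -> (forall c u v, P u -> P v -> P (c *: u + v)) ->
  (forall k u, P u -> P (free_gen F k * u)) -> forall u, P u.
Proof.
move=> P0 P1 Plin Pgen u; rewrite [u]monalgE.
apply: big_ind => // [a b Pa Pb|w _]; first by rewrite -[a]scale1r; exact: Plin.
have -> : << u@_w *g w >> = u@_w *: (<< w >> : free_alg3 F) + 0.
  by rewrite addr0 -mul_malgC malgM_def fgmulUU mulr1 mul1m.
apply: Plin => //.
case: w => s; elim: s => [|k s IH]; first by rewrite -fmoneE.
have -> : << FMonom (k :: s) >> = free_gen F k * (<< FMonom s >> : free_alg3 F).
  rewrite [RHS]malgM_def fgmulUU mulr1; congr << _ >>.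
  by rewrite fmuE [RHS]fmmulE.
exact: Pgen.
Qed.

(** Any three operators on [V] extend to an action of the free algebra, because
    the words in the generators are a basis of it. *)
Variables (V : lmodType F) (e : 'I_3 -> {linear V -> V}).

Definition word_act (w : {fmonom 'I_3}) (v : V) : V :=
  foldr (fun k => e k) v w.

Definition act (u : free_alg3 F) (v : V) : V :=
  \sum_(w <- msupp u) u@_w *: word_act w v.

Lemma word_act_is_linear w : linear (word_act w).
Proof.
move=> c a b; rewrite /word_act; elim: {w}(w : seq _) => //= k s ->.
by rewrite linearP.
Qed.

HB.instance Definition _ w :=
  GRing.isLinear.Build F V V *:%R (word_act w) (word_act_is_linear w).

Lemma actEw (d : {fset {fmonom 'I_3}}) (u : free_alg3 F) v :
  (msupp u `<=` d)%fset -> act u v = \sum_(w <- d) u@_w *: word_act w v.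
Proof.
move=> le; rewrite /act (big_fset_incl _ le) //= => w _ /mcoeff_outdom ->.
by rewrite scale0r.
Qed.

Lemma actU c w v :
  act (<< c *g w >> : {malg F[{fmonom 'I_3}]}) v = c *: word_act w v.
Proof. by rewrite (actEw _ msuppU_le) big_seq_fset1 mcoeffUU. Qed.

(** [act] with its arguments exchanged, so that linearity in the element of the
    algebra can be declared as a structure. *)
Definition orbit_map (v : V) (u : free_alg3 F) : V := act u v.

Lemma orbit_map_is_linear v : linear (orbit_map v).
Proof.
move=> c u u'; rewrite /orbit_map; set d := (msupp u `|` msupp u')%fset.
have le1 : (msupp u `<=` d)%fset by exact: fsubsetUl.
have le2 : (msupp u' `<=` d)%fset by exact: fsubsetUr.
have le3 : (msupp (c *: u + u') `<=` d)%fset.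
  apply: fsubset_trans (msuppD_le _ _) _.
  by rewrite fsetSU // msuppZ_le.
rewrite (actEw _ le1) (actEw _ le2) (actEw _ le3) scaler_sumr -big_split /=.
apply: eq_bigr => w _ /=.
by rewrite mcoeffD mcoeffZ scalerDl scalerA.
Qed.

HB.instance Definition _ v :=
  GRing.isLinear.Build F (free_alg3 F) V *:%R (orbit_map v)
    (orbit_map_is_linear v).

Lemma act_is_linear u : linear (act u).
Proof.
move=> c a b; rewrite /act scaler_sumr -big_split /=; apply: eq_bigr => w _.
by rewrite linearP scalerDr !scalerA mulrC.
Qed.

Lemma act0l v : act 0 v = 0.
Proof. exact: (linear0 (orbit_map v)). Qed.

Lemma actDl u u' v : act (u + u') v = act u v + act u' v.
Proof. exact: (linearD (orbit_map v)). Qed.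

Lemma actBl u u' v : act (u - u') v = act u v - act u' v.
Proof. exact: (linearB (orbit_map v)). Qed.

Lemma actZl c u v : act (c *: u) v = c *: act u v.
Proof. exact: (linearZZ (orbit_map v)). Qed.

HB.instance Definition _ u :=
  GRing.isLinear.Build F V V *:%R (act u) (act_is_linear u).

Lemma act1 v : act 1 v = v.
Proof. by rewrite actU scale1r /word_act fm1. Qed.

Lemma act_gen k v : act (free_gen F k) v = e k v.
Proof. by rewrite actU scale1r /word_act fmuE. Qed.

Lemma actM u u' v : act (u * u') v = act u (act u' v).
Proof.
rewrite [u * u']malgME [LHS](linear_sum (orbit_map v)); apply: eq_bigr => w _.
rewrite [LHS]linear_sum /act linear_sum scaler_sumr.
apply: eq_bigr => w' _ /=.
by rewrite /orbit_map actU linearZ /= scalerA /word_act fmM foldr_cat.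
Qed.

Lemma act_ideal (S : free_alg3 F -> Prop) u :
  (forall s v, S s -> act s v = 0) -> ideal_generated S u ->
  forall v, act u v = 0.
Proof.
move=> S0; elim=> {u} [u Su||u u' _ IH _ IH'|a u _ IH|a u _ IH] v.
- exact: S0.
- exact: act0l.
- by rewrite actDl IH IH' addr0.
- by rewrite actM IH linear0.
- by rewrite actM IH.
Qed.

End FreeAlgebra.

(** * Left multiplication on normal forms *)

(** The term [x^i a y^k], as its family of coefficients. *)
Definition monomial {F : fieldType} (i k : nat) (a : {poly F}) :
    nat -> nat -> {poly F} :=
  fun i' k' => a *+ ((i' == i) && (k' == k)).

Section NormalForms.

Context {F : fieldType} (q : F) (f g : {poly F}).

Local Notation H := (qgha q f g).
Local Notation X := (qghaX q f g).
Local Notation Y := (qghaY q f g).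
Local Notation iota := (horner_alg (qghaH q f g)).
Local Notation V := (nat -> nat -> {poly F}).

(** [v : V] stands for the formal sum of all [x^i (v i k) y^k], which may be
    infinite. *)
Definition mulX (v : V) : V := fun i k => if i is i'.+1 then v i' k else 0.

Definition mulH (v : V) : V := fun i k => rep_h f i * v i k.

(** The coefficient of [x^i y^k] in [y v] comes from [x^i y^(k-1)], where [y]
    crosses [x^i] and the coefficient, and from [x^(i+1) y^k], where [y] meets
    one of the factors [x] and leaves [g]; [rep_y q f g i.+1] sums the latter
    contributions over these factors. *)
Definition mulY (v : V) : V := fun i k =>
  (if k is k'.+1 then q ^+ i *: (v i k' \Po f) else 0)
  + rep_y q f g i.+1 * v i.+1 k.

Lemma mulX_is_linear : linear mulX.
Proof.
move=> c u v; apply/funext => i; apply/funext => k; case: i => //=.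
by rewrite /mulX [RHS]/GRing.add /= [in RHS]/GRing.scale /= scaler0 addr0.
Qed.

Lemma mulH_is_linear : linear mulH.
Proof.
move=> c u v; apply/funext => i; apply/funext => k.
by rewrite /mulH [LHS]mulrDr -scalerAr.
Qed.

Lemma mulY_is_linear : linear mulY.
Proof.
move=> c u v; apply/funext => i; apply/funext => k; rewrite /mulY.
rewrite [_ * _]mulrDr -scalerAr.
transitivity (c *: mulY u i k + mulY v i k) => //; rewrite /mulY.
rewrite !scalerDr addrACA; congr (_ + _).
case: k => [|k]; first by rewrite scaler0 addr0.
by rewrite comp_polyD comp_polyZ scalerDr !scalerA mulrC.
Qed.

HB.instance Definition _ := GRing.isLinear.Build F V V *:%R mulX mulX_is_linear.
HB.instance Definition _ := GRing.isLinear.Build F V V *:%R mulH mulH_is_linear.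
HB.instance Definition _ := GRing.isLinear.Build F V V *:%R mulY mulY_is_linear.

Definition mul_gen (k : 'I_3) : {linear V -> V} :=
  match val k with 0 => mulX | 1 => mulY | _ => mulH end.

(** [rep_h f i] is the [i]-fold composite of [f] with itself, defined by adding
    factors on the left; composition being associative, they may as well be
    added on the right. *)
Lemma rep_h_comp i : rep_h f i \Po f = rep_h f i.+1.
Proof.
elim: i => [|i /= IH]; first by rewrite /= comp_polyX comp_polyXr.
by rewrite -comp_polyA IH.
Qed.

Lemma act_horner p v i k :
  act mul_gen (horner_alg (freeH F) p) v i k = (p \Po rep_h f i) * v i k.
Proof.
elim/poly_ind: p v => [|p c IH] v.
  by rewrite rmorph0 act0l comp_poly0 mul0r.
rewrite rmorphD rmorphM /= horner_algX horner_algC actDl actZl actM act1.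
rewrite [LHS]/(_ + _) /= IH act_gen comp_polyD comp_polyM comp_polyX comp_polyC.
by rewrite mulrDl -mulrA mul_polyC.
Qed.

(** The relations hold as identities between the operators. *)
Lemma act_qgha_rel u v i k : qgha_rel q f g u -> act mul_gen u v i k = 0.
Proof.
have actX w : act mul_gen (freeX F) w = mulX w by exact: act_gen.
have actY w : act mul_gen (freeY F) w = mulY w by exact: act_gen.
have actH w : act mul_gen (freeH F) w = mulH w by exact: act_gen.
have actf := act_horner f; have actg := act_horner g.
(* Only the action of the generators matters: as elements of the free algebra
   they are generalized, and so are their products below. *)
case; move: actf actg actX actY actH.
all: move: (horner_alg (freeH F) f) (horner_alg (freeH F) g).
all: move: (freeX F) (freeY F) (freeH F).
all: move=> x y h hf hg actf actg actX actY actH.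
- have E1 : act mul_gen (h * x) v = mulH (mulX v).
    by rewrite actM actX; exact: actH.
  have E2 : act mul_gen (x * hf) v = mulX (act mul_gen hf v).
    by rewrite actM; exact: actX.
  move: (h * x) (x * hf) E1 E2 => a b E1 E2.
  rewrite actBl E1 E2; apply/eqP; rewrite subr_eq0 /mulH /mulX; apply/eqP.
  by case: i => [|i]; rewrite ?mulr0 ?actf.
- have E1 : act mul_gen (y * h) v = mulY (mulH v).
    by rewrite actM actH; exact: actY.
  have E2 : act mul_gen (hf * y) v = act mul_gen hf (mulY v).
    by rewrite actM actY.
  move: (y * h) (hf * y) E1 E2 => a b E1 E2.
  rewrite actBl E1 E2; apply/eqP; rewrite subr_eq0 actf /mulH /mulY; apply/eqP.
  rewrite mulrDr mulrCA; congr (_ + _).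
  case: k => [|k]; first by rewrite mulr0.
  by rewrite comp_polyM rep_h_comp scalerAr.
- have E1 : act mul_gen (y * x) v = mulY (mulX v).
    by rewrite actM actX; exact: actY.
  have E2 : act mul_gen (x * y) v = mulX (mulY v).
    by rewrite actM actY; exact: actX.
  move: (y * x) (x * y) E1 E2 => a b E1 E2.
  rewrite !actBl actZl E1 E2; apply/eqP; rewrite subr_eq0; apply/eqP.
  rewrite actg; transitivity (mulY (mulX v) i k - q *: mulX (mulY v) i k) => //.
  rewrite /mulX /mulY; case: i => [|i] /=.
    rewrite mulr0 add0r scaler0 subr0; case: k => [|k]; first by rewrite add0r.
    by rewrite comp_poly0 scaler0 add0r.
  rewrite mulrDl scalerDr -mulrA mul_polyC opprD addrACA.
  rewrite [X in _ + X]addrC addKr exprS.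
  case: k => [|k]; first by rewrite scaler0 subrr add0r.
  by rewrite scalerA subrr add0r.
Qed.

Definition qgha_act (a : H) : V -> V := act mul_gen (qgha_lift a).

(** Representatives of the same element act alike, since the ideal acts by
    zero. *)
Lemma qgha_act_proj u v : qgha_act (qgha_proj q f g u) v = act mul_gen u v.
Proof.
apply/eqP; rewrite -subr_eq0 -actBl; apply/eqP.
have /qgha_idealP Iu := qgha_projK q f g u.
apply: (act_ideal _ Iu) => s w Ss.
by apply/funext => i; apply/funext => k; exact: act_qgha_rel.
Qed.

Lemma qgha_act_is_linear v : linear (qgha_act^~ v).
Proof.
move=> c a b; rewrite -(qgha_liftK a) -(qgha_liftK b) -linearP !qgha_act_proj.
by rewrite actDl actZl.
Qed.

Lemma qgha_actM a b v : qgha_act (a * b) v = qgha_act a (qgha_act b v).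
Proof.
rewrite -(qgha_liftK a) -(qgha_liftK b).
by rewrite -[_ * _](rmorphM (qgha_proj q f g)) !qgha_act_proj actM.
Qed.

Lemma qgha_act1 v : qgha_act 1 v = v.
Proof. by rewrite -[1](rmorph1 (qgha_proj q f g)) qgha_act_proj act1. Qed.

(** The coordinates of an element are its action on the formal sum [1]. *)
Definition qgha_coord (a : H) : V := qgha_act a (monomial 0 0 1).

Lemma qgha_coord_is_linear : linear qgha_coord.
Proof. exact: qgha_act_is_linear. Qed.

HB.instance Definition _ :=
  GRing.isLinear.Build F H V *:%R qgha_coord qgha_coord_is_linear.

Lemma qgha_actX v : qgha_act X v = mulX v.
Proof. by rewrite qgha_act_proj act_gen. Qed.

Lemma qgha_actY v : qgha_act Y v = mulY v.
Proof. by rewrite qgha_act_proj act_gen. Qed.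

Lemma qgha_act_iota p v i k :
  qgha_act (iota p) v i k = (p \Po rep_h f i) * v i k.
Proof. by rewrite -qgha_proj_horner qgha_act_proj act_horner. Qed.

(** Why normal forms are unique: on the formal sum [1], the powers of [y] only
    raise the exponent of [y] because no [x] is there to be met, the polynomial
    in [h] is then put in place, and the powers of [x] are added last. *)
Lemma qgha_coord_monomial i k a :
  qgha_coord (X ^+ i * iota a * Y ^+ k) = monomial i k a.
Proof.
rewrite /qgha_coord !qgha_actM.
have -> : qgha_act (Y ^+ k) (monomial 0 0 1) = monomial 0 k 1.
  elim: k => [|k IH]; first by rewrite expr0 qgha_act1.
  rewrite exprS qgha_actM IH qgha_actY /mulY.
  apply/funext => i'; apply/funext => k'.
  rewrite /monomial /= mulr0 addr0; case: k' => [|k']; first by rewrite andbF.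
  by case: i' => [|i'] /=; rewrite ?comp_poly0 ?scaler0 // eqSS; case: eqP;
    rewrite ?comp_polyC ?comp_poly0 expr0 scale1r.
have -> : qgha_act (iota a) (monomial 0 k 1) = monomial 0 k a.
  apply/funext => i'; apply/funext => k'; rewrite qgha_act_iota /monomial.
  by case: i' => [|i'] /=; rewrite ?mulr0 // comp_polyXr mulr_natr.
elim: i => [|i IH]; first by rewrite expr0 qgha_act1.
rewrite exprS qgha_actM IH qgha_actX; apply/funext => i'; apply/funext => k'.
by case: i'.
Qed.

(** The form in which generation is used: left multiplications by the
    generators reach every word from [1]. *)
Lemma qgha_ind (P : H -> Prop) :
  P 0 -> P 1 -> (forall c u v, P u -> P v -> P (c *: u + v)) ->
  (forall u, P u -> [/\ P (X * u), P (Y * u) & P (qghaH q f g * u)]) ->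
  forall r, P r.
Proof.
move=> P0 P1 Plin Pgen r; rewrite -(qgha_liftK r).
apply: (free_alg3_ind (P := P \o qgha_proj q f g)) => /= [||c u v Pu Pv|k u Pu].
- by rewrite raddf0.
- exact: P1.
- by rewrite linearP; exact: Plin.
have [PX PY PH] := Pgen _ Pu; rewrite (rmorphM (qgha_proj q f g)).
have : [\/ k = 0, k = 1 | k = 2].
  case: k => [[|[|[|//]]] lt_k]; [apply: Or31 | apply: Or32 | apply: Or33];
    exact: val_inj.
by case=> ->; [exact: PX | exact: PY | exact: PH].
Qed.

Lemma qghaYX : Y * X = q *: (X * Y) + iota g.
Proof. by rewrite -qgha_yx addrC subrK. Qed.

End NormalForms.

(** * Linear combinations and bases *)

Section Span.

Variables (F : fieldType) (V : lmodType F) (I : eqType) (v : I -> V).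

Definition spanned (u : V) : Prop :=
  exists (s : seq I) (c : I -> F), u = \sum_(i <- s) c i *: v i.

(** Linear combinations along different lists can be added once both are moved
    to a common duplicate-free list; multiplicities make up for repetitions. *)
Lemma sum_count_mem (s t : seq I) (a : I -> V) : uniq t -> {subset s <= t} ->
  \sum_(i <- s) a i = \sum_(i <- t) a i *+ count_mem i s.
Proof.
move=> Ut; elim: s => [|j s IH] st.
  by rewrite big_nil big1.
rewrite big_cons IH => [|i si]; last by rewrite st // inE si orbT.
under [RHS]eq_bigr => i _ do rewrite /= mulrnDr.
rewrite big_split /=; congr (_ + _).
rewrite (bigD1_seq j) ?st ?mem_head //= eqxx big1 ?addr0 // => i ij.
by rewrite eq_sym (negPf ij).
Qed.

Lemma spanned0 : spanned 0.
Proof. by exists [::], (fun=> 0); rewrite big_nil. Qed.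

Lemma spannedD u u' : spanned u -> spanned u' -> spanned (u + u').
Proof.
move=> [s [c ->]] [s' [c' ->]].
exists (undup (s ++ s')).
exists (fun i => c i *+ count_mem i s + c' i *+ count_mem i s').
rewrite (@sum_count_mem s (undup (s ++ s'))) ?undup_uniq //; last first.
  by move=> i si; rewrite mem_undup mem_cat si.
rewrite (@sum_count_mem s' (undup (s ++ s'))) ?undup_uniq //; last first.
  by move=> i si; rewrite mem_undup mem_cat si orbT.
by rewrite -big_split; apply: eq_bigr => i _; rewrite /= scalerDl !scalerMnl.
Qed.

Lemma spannedZ c i : spanned (c *: v i).
Proof. by exists [:: i], (fun=> c); rewrite big_seq1. Qed.

Lemma spanned_sum (T : Type) (s : seq T) (u : T -> V) :
  (forall t, spanned (u t)) -> spanned (\sum_(t <- s) u t).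
Proof.
by move=> su; apply: big_ind => //; [exact: spanned0 | exact: spannedD].
Qed.

End Span.

(** Triangularity: the leading terms cannot cancel. *)
Lemma graded_basis (F : fieldType) (v : nat -> {poly F}) :
  (forall j, size (v j) = j.+1) -> is_basis v.
Proof.
move=> sv; have v0 j : (v j)`_j != 0.
  have := lead_coef_eq0 (v j); rewrite /lead_coef sv /= => ->.
  by rewrite -size_poly_eq0 sv.
split=> [s c Us E i si|u].
  have [//|ci0] := eqVneq (c i) 0.
  have exP : exists m, (m \in s) && (c m != 0) by exists i; rewrite si.
  have ubP m : (m \in s) && (c m != 0) -> (m <= \max_(j <- s) j)%N.
    by case/andP=> sm _; exact: (@leq_bigmax_seq _ s xpredT id).
  case: (ex_maxnP exP ubP) => m /andP[sm cm] mmax.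
  (* [m] is the largest degree that occurs with a nonzero coefficient. *)
  have := congr1 (fun p : {poly F} => p`_m) E.
  rewrite coef_sum coef0 (bigD1_seq m) //= big_seq_cond big1 ?addr0.
    by move/eqP; rewrite coefZ mulf_eq0 (negPf cm) (negPf (v0 m)).
  move=> j /andP[sj jm]; rewrite coefZ.
  have [->|cj] := eqVneq (c j) 0; first by rewrite mul0r.
  have := mmax j; rewrite sj cj leq_eqVlt (negPf jm) => /(_ isT) /= ltjm.
  by rewrite nth_default ?mulr0 // sv.
have [n le_u_n] := ubnP (size u); elim: n u le_u_n => // n IH u.
rewrite ltnS => le_u_n.
have [->|u0] := eqVneq u 0; first exact: spanned0.
pose j := (size u).-1; pose c := u`_j / (v j)`_j.
have size_u : size u = j.+1 by rewrite prednK // size_poly_gt0.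
rewrite -[u](subrK (c *: v j)); apply: spannedD; last exact: spannedZ.
apply: IH; apply: leq_trans le_u_n; rewrite size_u ltnS.
apply/leq_sizeP => i; rewrite leq_eqVlt coefB coefZ => /predU1P[<-|lt_ji].
  by rewrite divfK ?subrr.
by rewrite !nth_default ?mulr0 ?subr0 // ?sv ?size_u.
Qed.

Lemma sum_delta (V : nmodType) (n i : nat) (a : nat -> V) :
  \sum_(l < n) a l *+ (i == l) = a i *+ (i < n)%N.
Proof.
under eq_bigr => l _ do rewrite mulrb eq_sym.
by rewrite -big_mkcond big_ord1_eq mulrb.
Qed.

(** * The Ore structure of an algebra with unique normal forms *)

Section OreStructure.

Variables (F : fieldType) (q : F) (f g : {poly F}).
Variables (R : algType F) (x y h : R).
Local Notation iota := (horner_alg h).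
Local Notation V := (nat -> nat -> {poly F}).

Hypothesis mul_hx : h * x = x * iota f.
Hypothesis mul_yh : y * h = iota f * y.
Hypothesis mul_yx : y * x = q *: (x * y) + iota g.
(* [x], [y] and [h] generate [R]. *)
Hypothesis gen_ind : forall P : R -> Prop,
  P 0 -> P 1 -> (forall c u v, P u -> P v -> P (c *: u + v)) ->
  (forall u, P u -> [/\ P (x * u), P (y * u) & P (h * u)]) -> forall r, P r.
(* The coefficients [a] in a normal form, indexed by the exponents of [x] and
   [y]. *)
Variable coord : {linear R -> V}.
Hypothesis coord_monomial : forall i k a,
  coord (x ^+ i * iota a * y ^+ k) = monomial i k a.

Lemma y_iota a : y * iota a = iota (a \Po f) * y.
Proof.
elim/poly_ind: a => [|a c IH]; first by rewrite comp_poly0 !rmorph0 mul0r mulr0.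
rewrite comp_polyD comp_polyM comp_polyX comp_polyC !rmorphD !rmorphM /=.
rewrite horner_algX horner_algC mulrDr mulrDl mulrA IH -!mulrA mul_yh.
by rewrite -scalerAr mulr1 -scalerAl mul1r.
Qed.

Lemma iota_x a : iota a * x = x * iota (a \Po f).
Proof.
elim/poly_ind: a => [|a c IH]; first by rewrite comp_poly0 !rmorph0 mul0r mulr0.
rewrite comp_polyD comp_polyM comp_polyX comp_polyC !rmorphD !rmorphM /=.
rewrite horner_algX horner_algC mulrDr mulrDl -mulrA mul_hx mulrA IH -mulrA.
by rewrite -scalerAr mulr1 -scalerAl mul1r.
Qed.

(** The normal forms without [x].  Evaluation in a noncommutative ring puts the
    coefficients on the left of the powers of [y], as is wanted here. *)
Definition skew_eval (p : {poly {poly F}}) : R := (map_poly iota p).[y].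

Lemma skew_evalE p : skew_eval p = \sum_(k < size p) iota p`_k * y ^+ k.
Proof.
rewrite /skew_eval (@horner_coef_wide _ (size p)) ?size_poly //.
by apply: eq_bigr => k _; rewrite coef_map.
Qed.

Lemma skew_eval_is_additive : {morph skew_eval : p r / p - r}.
Proof. by move=> p r; rewrite /skew_eval rmorphB hornerD hornerN. Qed.

HB.instance Definition _ :=
  GRing.isZmodMorphism.Build {poly {poly F}} R skew_eval skew_eval_is_additive.

Lemma skew_evalZ a p : skew_eval (a *: p) = iota a * skew_eval p.
Proof. by rewrite /skew_eval map_polyZ hornerZ. Qed.

Lemma skew_evalC a : skew_eval a%:P = iota a.
Proof. by rewrite /skew_eval map_polyC hornerC. Qed.

Lemma skew_evalMX p : skew_eval (p * 'X) = skew_eval p * y.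
Proof. by rewrite /skew_eval rmorphM /= map_polyX hornerMX. Qed.

Lemma y_skew_eval p :
  y * skew_eval p = skew_eval (map_poly (comp_poly f) p * 'X).
Proof.
rewrite skew_evalMX; elim/poly_ind: p => [|p a IH].
  by rewrite rmorph0 !raddf0 mul0r mulr0.
rewrite rmorphD rmorphM /= map_polyX map_polyC !raddfD /= !skew_evalMX.
rewrite !skew_evalC.
by rewrite mulrDr mulrDl mulrA IH y_iota.
Qed.

(** The source of all the uniqueness statements below. *)
Lemma coord_ore i p i' k :
  coord (x ^+ i * skew_eval p) i' k = p`_k *+ (i' == i).
Proof.
rewrite skew_evalE mulr_sumr linear_sum !fct_sumE.
under eq_bigr => l _ do rewrite mulrA coord_monomial /monomial -mulnb mulrnA.
rewrite [LHS](sum_delta _ _ (fun l => p`_l *+ (i' == i))).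
by case: ltnP => // lepk; rewrite nth_default // mul0rn.
Qed.

Definition skew_pred : {pred R} :=
  fun b => `[< exists p, b = skew_eval p >].

Lemma skew_predP b : reflect (exists p, b = skew_eval p) (b \in skew_pred).
Proof. exact: asboolP. Qed.

Lemma skew_pred_eval p : skew_eval p \in skew_pred.
Proof. by apply/skew_predP; exists p. Qed.

Lemma skew_subalg_closed : subalg_closed skew_pred.
Proof.
split=> [|c u v|u v].
- by apply/skew_predP; exists 1; rewrite skew_evalC rmorph1.
- move=> /skew_predP[p ->] /skew_predP[r ->].
  apply/skew_predP; exists (c%:P *: p + r).
  by rewrite raddfD /= skew_evalZ horner_algC -scalerAl mul1r.
move=> /skew_predP[p ->] Sv.
elim/poly_ind: p v Sv => [|p a IH] v /skew_predP[r ->].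
  by apply/skew_predP; exists 0; rewrite !raddf0 mul0r.
rewrite raddfD /= skew_evalMX skew_evalC mulrDl -mulrA y_skew_eval.
rewrite -skew_evalZ.
have /skew_predP[s ->] := IH _ (skew_pred_eval (map_poly (comp_poly f) r * 'X)).
by rewrite -raddfD; exact: skew_pred_eval.
Qed.

HB.instance Definition _ :=
  GRing.isSubalgClosed.Build F R skew_pred skew_subalg_closed.

(** The subalgebra generated by [y] and [h], which will be the skew polynomial
    ring. *)
Record skew_sub : Type := SkewSub { skew_val : R; _ : skew_val \in skew_pred }.

HB.instance Definition _ := [isSub for skew_val].
HB.instance Definition _ := [Choice of skew_sub by <:].
HB.instance Definition _ := [SubChoice_isSubAlgebra of skew_sub by <:].

Lemma skew_val_is_linear : linear skew_val.
Proof. exact: (linearP val). Qed.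

Lemma skew_val_is_monoid_morphism : monoid_morphism skew_val.
Proof. by split; [exact: rmorph1 val | exact: (rmorphM val)]. Qed.

HB.instance Definition _ :=
  GRing.isLinear.Build F skew_sub R *:%R skew_val skew_val_is_linear.
HB.instance Definition _ :=
  GRing.isMonoidMorphism.Build skew_sub R skew_val
    skew_val_is_monoid_morphism.

Lemma skew_subP (b : skew_sub) : exists p, skew_val b = skew_eval p.
Proof. by apply/skew_predP; case: b. Qed.

Lemma coord_x_skew i (b : skew_sub) i' k :
  coord (x ^+ i * skew_val b) i' k = coord (skew_val b) 0 k *+ (i' == i).
Proof.
have [p ->] := skew_subP b; rewrite coord_ore.
by rewrite -[skew_eval p]mul1r -(expr0 x) coord_ore.
Qed.

Lemma coord_skew_eval p k : coord (skew_eval p) 0 k = p`_k.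
Proof. by rewrite -[skew_eval p]mul1r -(expr0 x) coord_ore. Qed.

Lemma skew_coord_inj (b b' : skew_sub) :
  coord (skew_val b) 0 = coord (skew_val b') 0 -> b = b'.
Proof.
move=> eq_bb'; apply: val_inj.
have [p Ep] := skew_subP b; have [p' Ep'] := skew_subP b'.
have -> : val b = skew_eval p by [].
have -> : val b' = skew_eval p' by [].
congr skew_eval; apply/polyP => k.
by rewrite -!coord_skew_eval -Ep -Ep' eq_bb'.
Qed.

Lemma y_in_skew : y \in skew_pred.
Proof.
by apply/skew_predP; exists 'X; rewrite /skew_eval map_polyX hornerX.
Qed.

Lemma iota_in_skew a : iota a \in skew_pred.
Proof. by apply/skew_predP; exists a%:P; rewrite skew_evalC. Qed.

Lemma h_in_skew : h \in skew_pred.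
Proof. by rewrite -(horner_algX h); exact: iota_in_skew. Qed.

Definition y_skew : skew_sub := SkewSub y_in_skew.
Definition h_skew : skew_sub := SkewSub h_in_skew.

(** [horner_alg h_skew] is declared linear only for the scaling by the images of
    the scalars in [skew_sub]; this copy is [F]-linear. *)
Definition iota_skew (a : {poly F}) : skew_sub := horner_alg h_skew a.

Lemma iota_skew_is_linear : linear iota_skew.
Proof.
move=> c a b; rewrite /iota_skew rmorphD -mul_polyC rmorphM /= horner_algC.
by rewrite -scalerAl mul1r.
Qed.

Lemma iota_skew_is_monoid_morphism : monoid_morphism iota_skew.
Proof. by split; [exact: rmorph1 | exact: rmorphM]. Qed.

HB.instance Definition _ :=
  GRing.isLinear.Build F {poly F} skew_sub *:%R iota_skew iota_skew_is_linear.
HB.instance Definition _ :=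
  GRing.isMonoidMorphism.Build {poly F} skew_sub iota_skew
    iota_skew_is_monoid_morphism.

Lemma skew_val_iota a : skew_val (iota_skew a) = iota a.
Proof. exact: (lrmorph_horner_alg skew_val). Qed.

Lemma skew_sub_is_skew_polynomial_ring :
  is_skew_polynomial_ring (comp_poly f) iota_skew y_skew.
Proof.
have valE (p : {poly {poly F}}) :
    skew_val (\sum_(k < size p) iota_skew p`_k * y_skew ^+ k)
      = skew_eval p.
  rewrite skew_evalE rmorph_sum; apply: eq_bigr => k _.
  by rewrite rmorphM rmorphXn /= skew_val_iota.
split=> [a|b].
  apply: val_inj; rewrite !(rmorphM val) /=.
  by rewrite !skew_val_iota; exact: y_iota.
have [p Ep] := skew_subP b; exists p; split.
  by apply: val_inj; rewrite [RHS]valE.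
move=> p' Ep'; apply/polyP => k.
by rewrite -!coord_skew_eval -Ep -valE -Ep'.
Qed.

Lemma ore_pair_inj (t d t' d' : skew_sub) :
  x * skew_val t + skew_val d = x * skew_val t' + skew_val d' ->
  t = t' /\ d = d'.
Proof.
move=> E.
have cE (a b : skew_sub) i k : coord (x * skew_val a + skew_val b) i k
    = coord (skew_val a) 0 k *+ (i == 1) + coord (skew_val b) 0 k *+ (i == 0).
  rewrite -{1}(expr1 x) -{1}[skew_val b]mul1r -{1}(expr0 x) linearD.
  by rewrite -!coord_x_skew.
split; apply: skew_coord_inj; apply/funext => k.
  by have := cE t d 1 k; rewrite E cE !addr0.
by have := cE t d 0 k; rewrite E cE !add0r.
Qed.

(** Induction on the degree of [b] in [y]: by the relation between [x] and [y],
    the last factor [y] of [b] may be moved to the right of [x], which leaves a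
    term without [x] and an element of smaller degree in front of [x]. *)
Lemma ore_pair_ex (b : skew_sub) :
  exists td : skew_sub * skew_sub,
    skew_val b * x = x * skew_val td.1 + skew_val td.2.
Proof.
suff [t [d [St Sd E]]] : exists t d, [/\ t \in skew_pred, d \in skew_pred
    & skew_val b * x = x * t + d] by exists (SkewSub St, SkewSub Sd).
have [p ->] := skew_subP b.
elim/poly_ind: p => [|p a [t [d [St Sd E]]]].
  by exists 0, 0; rewrite raddf0 mul0r mulr0 addr0; split; rewrite ?rpred0.
exists (q *: (t * y) + iota (a \Po f)).
exists (q *: (d * y) + skew_eval p * iota g); split.
- by rewrite rpredD ?rpredZ ?rpredM ?y_in_skew ?iota_in_skew.
- by rewrite rpredD ?rpredZ ?rpredM ?y_in_skew ?iota_in_skew ?skew_pred_eval.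
rewrite raddfD /= skew_evalMX skew_evalC mulrDl -mulrA mul_yx iota_x.
rewrite (mulrDr (skew_eval p)) -scalerAr (mulrA (skew_eval p)) E mulrDl.
rewrite scalerDr.
rewrite (mulrDr x) -(scalerAr _ x) (mulrA x) -!addrA; congr (_ + _).
by rewrite addrA addrC.
Qed.

Definition tau (b : skew_sub) : skew_sub := (projT1 (cid (ore_pair_ex b))).1.
Definition delta (b : skew_sub) : skew_sub := (projT1 (cid (ore_pair_ex b))).2.

Lemma tau_delta b : skew_val b * x = x * skew_val (tau b) + skew_val (delta b).
Proof. by rewrite /tau /delta; case: cid. Qed.

Lemma tau_delta_unique b t d :
  skew_val b * x = x * skew_val t + skew_val d -> tau b = t /\ delta b = d.
Proof. by rewrite tau_delta => /ore_pair_inj. Qed.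

Lemma tau_delta_linear c (b b' : skew_sub) :
  tau (c *: b + b') = c *: tau b + tau b'
  /\ delta (c *: b + b') = c *: delta b + delta b'.
Proof.
apply: tau_delta_unique; rewrite !linearP mulrDl -scalerAl !tau_delta.
by rewrite mulrDr scalerDr -scalerAr addrACA.
Qed.

(** Both identities come from [(b b') x = b (x tau b' + delta b')]. *)
Lemma tau_delta_mul (b b' : skew_sub) :
  tau (b * b') = tau b * tau b'
  /\ delta (b * b') = delta b * tau b' + b * delta b'.
Proof.
apply: tau_delta_unique; rewrite rmorphD !rmorphM /= -mulrA tau_delta mulrDr.
by rewrite mulrA tau_delta mulrDl -!mulrA addrA.
Qed.

Lemma tau_delta_iota a :
  tau (iota_skew a) = iota_skew (a \Po f)
  /\ delta (iota_skew a) = 0.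
Proof.
by apply: tau_delta_unique; rewrite !skew_val_iota rmorph0 addr0 iota_x.
Qed.

Lemma tau_delta_y : tau y_skew = q *: y_skew /\ delta y_skew = iota_skew g.
Proof.
by apply: tau_delta_unique; rewrite skew_val_iota linearZ /= -scalerAr.
Qed.

Lemma tau_linear : linear tau.
Proof. by move=> c b b'; have [] := tau_delta_linear c b b'. Qed.

Lemma delta_linear : linear delta.
Proof. by move=> c b b'; have [] := tau_delta_linear c b b'. Qed.

Lemma tau_monoid_morphism : monoid_morphism tau.
Proof.
split=> [|b b']; last by have [] := tau_delta_mul b b'.
have [+ _] := tau_delta_iota 1; by rewrite !rmorph1.
Qed.

HB.instance Definition _ :=
  GRing.isLinear.Build F skew_sub skew_sub *:%R tau tau_linear.
HB.instance Definition _ :=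
  GRing.isMonoidMorphism.Build skew_sub skew_sub tau tau_monoid_morphism.
HB.instance Definition _ :=
  GRing.isLinear.Build F skew_sub skew_sub *:%R delta delta_linear.

Definition ore_eval (P : {poly skew_sub}) : R :=
  \sum_(i < size P) x ^+ i * skew_val P`_i.

Lemma ore_evalEw n (P : {poly skew_sub}) :
  (size P <= n)%N -> ore_eval P = \sum_(i < n) x ^+ i * skew_val P`_i.
Proof.
move=> le; rewrite /ore_eval.
rewrite (big_ord_widen n (fun i => x ^+ i * skew_val P`_i)) //.
rewrite big_mkcond; apply: eq_bigr => i _; case: ltnP => // lePi.
by rewrite nth_default // rmorph0 mulr0.
Qed.

Lemma ore_evalP c (P P' : {poly skew_sub}) :
  ore_eval (c%:A *: P + P') = c *: ore_eval P + ore_eval P'.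
Proof.
set n := maxn (size (c%:A *: P + P')) (maxn (size P) (size P')).
rewrite !(@ore_evalEw n) ?leq_max ?leqnn ?orbT //.
rewrite scaler_sumr -big_split; apply: eq_bigr => i _ /=.
by rewrite coefD coefZ -scalerAl mul1r linearP mulrDr scalerAr.
Qed.

Lemma ore_evalD (P P' : {poly skew_sub}) :
  ore_eval (P + P') = ore_eval P + ore_eval P'.
Proof. by have := ore_evalP 1 P P'; rewrite !scale1r. Qed.

Lemma ore_evalC b : ore_eval b%:P = skew_val b.
Proof.
by rewrite (@ore_evalEw 1) ?size_polyC_leq1 // big_ord1 coefC mul1r.
Qed.

Lemma ore_evalMX (P : {poly skew_sub}) : ore_eval (P * 'X) = x * ore_eval P.
Proof.
rewrite (@ore_evalEw (size P).+1); last first.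
  by rewrite (leq_trans (size_polyMleq _ _)) // size_polyX addn2.
rewrite big_ord_recl /=.
rewrite coefMX rmorph0 mulr0 add0r mulr_sumr; apply: eq_bigr => i _.
by rewrite coefMX mulrA exprS.
Qed.

(** Moving [b] across one [x] replaces it by [tau b], at the price of a term
    [delta b] with one [x] less. *)
Lemma skew_mul_ore (b : skew_sub) (P : {poly skew_sub}) :
  exists P', skew_val b * ore_eval P = ore_eval P'.
Proof.
elim/poly_ind: P b => [|P b' IH] b.
  by exists 0; rewrite /ore_eval size_poly0 big_ord0 mulr0.
have [T ET] := IH (tau b); have [D ED] := IH (delta b).
exists (T * 'X + D + (b * b')%:P).
rewrite !ore_evalD !ore_evalMX !ore_evalC rmorphM mulrDr mulrA tau_delta.
by rewrite mulrDl -mulrA ET ED.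
Qed.

Lemma ore_eval_surj r : exists P, r = ore_eval P.
Proof.
elim/gen_ind: r => [||c _ _ [P ->] [P' ->]|_ [P ->]].
- by exists 0; rewrite /ore_eval size_poly0 big_ord0.
- by exists 1%:P; rewrite ore_evalC rmorph1.
- by exists (c%:A *: P + P'); rewrite ore_evalP.
split; first by exists (P * 'X); rewrite ore_evalMX.
  exact: (skew_mul_ore y_skew).
exact: (skew_mul_ore h_skew).
Qed.

Lemma coord_ore_eval (P : {poly skew_sub}) i k :
  coord (ore_eval P) i k = coord (skew_val P`_i) 0 k.
Proof.
rewrite linear_sum !fct_sumE.
under eq_bigr => l _ do rewrite coord_x_skew.
rewrite [LHS](sum_delta _ _ (fun l => coord (skew_val P`_l) 0 k)).
by case: ltnP => // lePi; rewrite nth_default // rmorph0 linear0.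
Qed.

Lemma skew_sub_is_right_ore_extension :
  is_right_ore_extension tau delta skew_val x.
Proof.
split=> [b b'|b|r]; first by have [] := tau_delta_mul b b'.
  exact: tau_delta.
have [P EP] := ore_eval_surj r; exists P; split=> // P' EP'.
apply/polyP => i; apply: skew_coord_inj; apply/funext => k.
by rewrite -!coord_ore_eval -EP -[ore_eval P']EP'.
Qed.

Lemma ambiskew_of_normal_forms :
  is_ambiskew_polynomial_ring (comp_poly f) g q iota x y.
Proof.
exists skew_sub, iota_skew, y_skew, tau, delta, skew_val; split.
- exact: skew_sub_is_skew_polynomial_ring.
- exact: skew_sub_is_right_ore_extension.
- by split=> [a|]; [have [] := tau_delta_iota a | have [] := tau_delta_y].
- by split=> [a|]; [have [] := tau_delta_iota a | have [] := tau_delta_y].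
- by split=> // a; exact: esym (skew_val_iota a).
Qed.

(** Refining the normal forms by a basis of the polynomials in [h].  Fixing the
    exponents [i] and [k] of a linear relation leaves a relation between the
    [v j], which is why independence is inherited from [v]. *)
Lemma normal_form_basis (v : nat -> {poly F}) : is_basis v ->
  is_basis (fun t : nat * nat * nat => x ^+ t.1.1 * iota (v t.1.2) * y ^+ t.2).
Proof.
move=> [free_v span_v].
have iotaZ c p : iota (c *: p) = c *: iota p.
  by rewrite -mul_polyC rmorphM /= horner_algC -scalerAl mul1r.
split=> [s c Us E [[i j] k] sijk|r].
  pose s' := [seq t.1.2 | t <- s & (i == t.1.1) && (k == t.2)].
  apply: (free_v s' (fun j' => c (i, j', k))).
  - rewrite map_inj_in_uniq ?filter_uniq // => -[[i1 j1] k1] [[i2 j2] k2].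
    rewrite !mem_filter /= => /andP[/andP[/eqP <- /eqP <-] _].
    by move=> /andP[/andP[/eqP <- /eqP <-] _] ->.
  - have := congr1 (fun a => coord a i k) E.
    rewrite linear0 linear_sum !fct_sumE => {}E.
    rewrite big_map big_filter -[RHS]E big_mkcond; apply: eq_bigr => t _.
    rewrite linearZ /= coord_monomial.
    transitivity (c t *: (v t.1.2 *+ ((i == t.1.1) && (k == t.2)))) => //.
    case: ifP => [|_]; last by rewrite mulr0n scaler0.
    by case: t => [[i1 j1] k1] /= /andP[/eqP <- /eqP <-]; rewrite mulr1n.
  - by apply/mapP; exists (i, j, k); rewrite ?mem_filter //= !eqxx.
have [P ->] := ore_eval_surj r.
apply: spanned_sum => i; have [p ->] := skew_subP P`_i.
rewrite skew_evalE mulr_sumr; apply: spanned_sum => k.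
have [s [c ->]] := span_v p`_k.
rewrite rmorph_sum mulr_suml mulr_sumr; apply: spanned_sum => j /=.
rewrite iotaZ -scalerAl -scalerAr mulrA.
exact: (spannedZ (fun t : nat * nat * nat =>
  x ^+ t.1.1 * iota (v t.1.2) * y ^+ t.2) (c j) ((i : nat), j, (k : nat))).
Qed.

End OreStructure.

(** * Quantum generalized Heisenberg algebras *)

Theorem lemma2p1 (F : fieldType) (q : F) (f g : {poly F}) :
  [/\ is_ambiskew_polynomial_ring (comp_poly f) g q
        (horner_alg (qghaH q f g)) (qghaX q f g) (qghaY q f g),
      forall v : nat -> {poly F}, is_basis v ->
        is_basis (fun t : nat * nat * nat =>
          qghaX q f g ^+ t.1.1 * horner_alg (qghaH q f g) (v t.1.2)
            * qghaY q f g ^+ t.2)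
    & forall v : nat -> {poly F}, (forall j, size (v j) = j.+1) ->
        is_basis v
        /\ is_basis (fun t : nat * nat * nat =>
             qghaX q f g ^+ t.1.1 * horner_alg (qghaH q f g) (v t.1.2)
               * qghaY q f g ^+ t.2)].
Proof.
have basis v : is_basis v -> is_basis (fun t : nat * nat * nat =>
    qghaX q f g ^+ t.1.1 * horner_alg (qghaH q f g) (v t.1.2)
      * qghaY q f g ^+ t.2).
  exact: (normal_form_basis (@qgha_hx _ q f g) (@qgha_yh _ q f g) (qghaYX q f g)
    (@qgha_ind _ q f g) (coord := @qgha_coord _ q f g)
    (@qgha_coord_monomial _ q f g)).
split=> [|//|v sv].
  exact: (ambiskew_of_normal_forms (@qgha_hx _ q f g) (@qgha_yh _ q f g)
    (qghaYX q f g) (@qgha_ind _ q f g) (coord := @qgha_coord _ q f g)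
    (@qgha_coord_monomial _ q f g)).
by have bv := graded_basis sv; split; [exact: bv | exact: basis].
Qed.
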